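(* Let $E$ be a Banach space. (a) Let $-\infty<a<b<\infty$, let $\Lambda$ be a well ordered subset of $[a,b]$ with $\min\Lambda=a$ and $\max\Lambda=b$ such that $[a,b)$ is the union of the disjoint intervals $[\alpha,S(\alpha))$, $\alpha\in\Lambda^{<b}$, let $(z_\alpha)_{\alpha\in\Lambda}$ be a family in $E$, and let $g:[a,b]\to E$ satisfy $g(t)=z_\alpha$ for $t\in[\alpha,S(\alpha))$, $\alpha\in\Lambda^{<b}$. Then $g$ is Bochner integrable if and only if the family $((S(\alpha)-\alpha)z_\alpha)_{\alpha\in\Lambda^{<b}}$ is absolutely summable. (b) Let $\Lambda$ be a well ordered subset of a real interval $[a,b)$, $-\infty<a<b\le\infty$, with $\min\Lambda=a$ and $\sup\Lambda=b$, such that $[a,b)$ is the union of the disjoint intervals $[\alpha,S(\alpha))$, $\alpha\in\Lambda$, let $(z_\alpha)_{\alpha\in\Lambda}$ be a family in $E$, and let $g:[a,b)\to E$ be defined by $g(t)=z_\alpha$ for $t\in[\alpha,S(\alpha))$, $\alpha\in\Lambda$. Then $g$ is locally Bochner integrable if and only if the family $((S(\alpha)-\alpha)z_\alpha)_{\alpha\in\Lambda}$ is locally absolutely summable.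
   Context: A subset $\Lambda$ of $\mathbb R\cup\{\infty\}$ is well ordered if each of its nonempty subsets has a smallest element. For $\beta\in\Lambda$ different from a possible maximum of $\Lambda$, $S(\beta)$ is the smallest element of $\Lambda$ greater than $\beta$ (the successor of $\beta$). $\Lambda^{<\gamma}=\{\alpha\in\Lambda:\alpha<\gamma\}$. In the claim the $S(\alpha)$ are successors in $\Lambda$. Let $\Gamma$ be a nonempty well ordered subset of $\mathbb R\cup\{\infty\}$, $m=\min\Gamma$, $s=\sup\Gamma$. A family $(x_\alpha)_{\alpha\in\Gamma}$ in a normed space is summable if to every $\gamma\in\Gamma\cup\{s\}$ there corresponds a unique element $\sigma(\gamma)$ of the space such that: (i) $\sigma(m)=0$, and if $\gamma$ is the successor in $\Gamma$ of some $\beta\in\Gamma$, then $\sigma(\gamma)=\sigma(\beta)+x_\beta$; (ii) if $\gamma>m$ is not a successor, then for each $\epsilon>0$ there is $\beta_\epsilon\in\Gamma^{<\gamma}$ such that $\|\sigma(\beta)-\sigma(\gamma)\|<\epsilon$ whenever $\beta\in\Gamma$ and $\beta_\epsilon\le\beta<\gamma$. The family is locally summable if such $\sigma(\gamma)$ are defined for every $\gamma\in\Gamma$. The family is (locally) absolutely summable if the family of real numbers $(\|x_\alpha\|)_{\alpha\in\Gamma}$ is (locally) summable. $g$ is Bochner integrable if it is strongly measurable and $t\mapsto\|g(t)\|$ is Lebesgue integrable; it is locally Bochner integrable on $[a,b)$ if it is Bochner integrable on every compact subinterval of $[a,b)$. *)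

(* Defs.v *)
From HB Require Import structures.
From mathcomp Require Import all_boot all_order all_algebra.
From mathcomp Require Import all_classical all_reals all_analysis.

Set Implicit Arguments.
Unset Strict Implicit.
Unset Printing Implicit Defensive.

Import Order.TTheory GRing.Theory Num.Theory.
Import numFieldNormedType.Exports.

Local Open Scope classical_set_scope.
Local Open Scope ring_scope.

Section well_ordered_sets.
Context {d : Order.disp_t} {T : porderType d}.
Implicit Types (A B : set T) (x m : T).

Definition is_minimum A m := A m /\ (forall x, A x -> (m <= x)%O).

Definition is_maximum A m := A m /\ (forall x, A x -> (x <= m)%O).

Definition well_ordered A :=
  forall B, B `<=` A -> B !=set0 -> exists m, is_minimum B m.

Definition below A x := [set y | A y /\ (y < x)%O].

Definition is_successor A x y := is_minimum [set z | A z /\ (x < z)%O] y.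

(* The default value [x] is returned only when [A] has no smallest element
   greater than [x]. *)
Definition successor A x : T := xget x (is_successor A x).

End well_ordered_sets.

Section summability.
Context {R : realType} {V : normedModType R}.
Implicit Types (Γ D : set (\bar R)) (x σ : \bar R -> V).

(* Subsets of R and +oo are represented as sets of extended reals not
   containing -oo. A family indexed by Γ is a total function of which only the
   values on Γ matter. The conditions on [σ] are imposed at the points of [D],
   where [D] is either Γ or Γ with its supremum added. *)
Definition partial_sums Γ D x σ :=
  [/\ forall m, is_minimum Γ m -> D m -> σ m = 0,
      forall β γ, Γ β -> D γ -> is_successor Γ β γ -> σ γ = σ β + x β
    & forall m γ, is_minimum Γ m -> D γ -> (m < γ)%E ->
        ~ (exists2 β, Γ β & is_successor Γ β γ) ->
        forall e : R, 0 < e ->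
          exists2 βe, below Γ γ βe &
            forall β, Γ β -> (βe <= β)%E -> (β < γ)%E -> `|σ β - σ γ| < e].

Definition has_unique_partial_sums Γ D x :=
  exists σ, partial_sums Γ D x σ /\
    forall σ', partial_sums Γ D x σ' -> forall γ, D γ -> σ' γ = σ γ.

(* To be used for a nonempty well ordered Γ not containing -oo *)
Definition wo_summable Γ x :=
  has_unique_partial_sums Γ (Γ `|` [set ereal_sup Γ]) x.

Definition locally_wo_summable Γ x := has_unique_partial_sums Γ Γ x.

End summability.

Section absolute_summability.
Context {R : realType} {V : normedModType R}.
Implicit Types (Γ : set (\bar R)) (x : \bar R -> V).

Definition absolutely_wo_summable Γ x :=
  wo_summable Γ (fun α => `|x α| : R^o).

Definition locally_absolutely_wo_summable Γ x :=
  locally_wo_summable Γ (fun α => `|x α| : R^o).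

End absolute_summability.

(* The real line with the Lebesgue measurable sets, rather than with the Borel
   sets as is [measurableTypeR R] *)
Notation lebesgueTypeR R :=
  (caratheodory_type (mu_ext (wlength (idfun : R -> R)))).

Section bochner.
Context {R : realType} {E : normedModType R}.
Local Notation mu := (@completed_lebesgue_measure R).
Implicit Types (D : set R) (g s : R -> E).

Definition simple_function D s :=
  finite_set (s @` D) /\
  forall y, measurable (D `&` s @^-1` [set y] : set (lebesgueTypeR R)).

Definition strongly_measurable D g :=
  exists s_ : nat -> R -> E, (forall n, simple_function D (s_ n)) /\
    {ae mu, forall t, D t -> s_ n t @[n --> \oo] --> g t}.

Definition bochner_integrable D g :=
  strongly_measurable D g /\ mu.-integrable D (fun t => `|g t|%:E).

Definition locally_bochner_integrable (a : R) (b : \bar R) g :=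
  forall c d : R, a <= c -> c <= d -> (d%:E < b)%E ->
    bochner_integrable `[c, d] g.

End bochner.

(* Main.v *)
Require Import Defs.
From HB Require Import structures.
From mathcomp Require Import all_boot all_order all_algebra.
From mathcomp Require Import all_classical all_reals all_analysis.
From mathcomp Require Import measurable_realfun.

Set Implicit Arguments.
Unset Strict Implicit.
Unset Printing Implicit Defensive.

Import Order.TTheory GRing.Theory Num.Theory.
Import numFieldNormedType.Exports.

Local Open Scope classical_set_scope.
Local Open Scope ring_scope.

(** The function g is constant on each of the countably many intervals
    [α, S α), so it is strongly measurable on every interval concerned, and
    Bochner integrability on an interval says only that the integral of |g| over
    it is finite (step_function_bochnerP).  Put F(t) = ∫_[a, t) |g|, with
    values in [0, +oo].  As a function on the index set, F obeys the rules that
    define the partial sums of the family |(S α - α) z_α|: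
    - F(a) = 0;
    - F(S α) = F(α) + (S α - α) |z_α|, because |g| = |z_α| on [α, S α);
    - at an index which is not a successor, F is the supremum of its values at
      the smaller indices.  Indeed F is left continuous, by monotone
      convergence, and such an index is a limit of smaller ones, because the
      intervals leave no gap below it.
    By transfinite induction these rules determine the partial sums as long as
    they stay finite.  Hence partial sums exist, and are unique, on a set D of
    indices if and only if F is finite on D (has_unique_partial_sumsP and
    step_function_partial_sumsP).

    In the bounded case D contains the supremum of the indices below b.  If it
    is b, then F(b) < +oo is what is claimed; otherwise the last interval ends at
    b, and F(b) exceeds a partial sum by a finite amount.  In the local case D
    is the index set itself, and every compact subinterval of [a, b) lies
    inside some [a, S α). *)

(** * Partial sums over a well ordered set *)

Section order_sums.
Context {R : realType}.
Implicit Types (Γ D : set (\bar R)) (m β γ : \bar R).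

Lemma well_ordered_setU_sup Γ D : well_ordered Γ ->
  D `<=` Γ `|` [set ereal_sup Γ] -> well_ordered D.
Proof.
move=> woΓ DΓ B BD B0.
have [[c [Bc Γc]]|noΓ] := pselect (B `&` Γ !=set0).
  have [||k [[Bk Γk] kmin]] := woΓ (B `&` Γ); [exact: subIsetr|by exists c|].
  exists k; split=> // x Bx; have [Γx|->] := DΓ _ (BD _ Bx); first exact: kmin.
  exact: ereal_sup_ubound.
have Bsup x : B x -> x = ereal_sup Γ.
  by move=> Bx; have [Γx|//] := DΓ _ (BD _ Bx); case: noΓ; exists x.
by case: B0 => c Bc; exists c; split=> // x Bx; rewrite (Bsup _ Bx) (Bsup _ Bc).
Qed.

(** [F] plays the role of the partial sums, but may take the value [+oo]. *)
Section monotone_partial_sums.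
Variables (Γ D : set (\bar R)) (m : \bar R) (x : \bar R -> R^o).
Variable F : \bar R -> \bar R.
Hypotheses (woΓ : well_ordered Γ) (Γm : is_minimum Γ m).
Hypotheses (ΓD : Γ `<=` D) (DΓ : D `<=` Γ `|` [set ereal_sup Γ]).
Hypothesis Fm : F m = 0%E.
Hypothesis F_succ : forall β γ, Γ β -> is_successor Γ β γ ->
  F γ = (F β + (x β)%:E)%E.
Hypothesis F_lim : forall γ, D γ -> (m < γ)%E ->
  ~ (exists2 β, Γ β & is_successor Γ β γ) ->
  F γ = ereal_sup (F @` below Γ γ).
Hypothesis F_mono : forall β γ, D β -> D γ -> (β <= γ)%E -> (F β <= F γ)%E.

Let min_le γ : D γ -> (m <= γ)%E.
Proof.
by move=> /DΓ[/Γm.2//|->]; apply: ereal_sup_ubound; exact: Γm.1.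
Qed.

(** Look at the first point [γ] where the two functions would differ.  They
    agree at all smaller points, so the rule which defines both at [γ] (minimum,
    successor or limit) makes them agree at [γ] as well. *)
Lemma partial_sumsE σ : partial_sums Γ D x σ ->
  forall γ, D γ -> F γ = (σ γ)%:E.
Proof.
move=> [σm σsucc σlim]; apply: contrapT => /existsNP[γ0 /not_implyP[Dγ0 Fγ0]].
have [||γ [[Dγ neq] γmin]] := well_ordered_setU_sup woΓ DΓ
    (B := [set γ | D γ /\ F γ <> (σ γ)%:E]); [by move=> ? []|by exists γ0|].
have IH β : D β -> (β < γ)%E -> F β = (σ β)%:E.
  move=> Dβ bg; apply: contrapT => nb.
  by have := γmin β (conj Dβ nb); rewrite leNgt bg.
apply: neq; have := min_le Dγ; rewrite le_eqVlt => /predU1P[<-|mγ].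
  by rewrite Fm (σm m Γm) ?Γm//; exact/ΓD/Γm.1.
have [[β Γβ sβ]|nosucc] := pselect (exists2 β, Γ β & is_successor Γ β γ).
  rewrite (F_succ Γβ sβ) (σsucc _ _ Γβ Dγ sβ) EFinD IH//; first exact: ΓD.
  exact: sβ.1.2.
have clo := σlim m γ Γm Dγ mγ nosucc.
rewrite F_lim//; apply/eqP; rewrite eq_le; apply/andP; split.
- apply: ge_ereal_sup => _ [β [Γβ βγ] <-].
  apply/lee_addgt0Pr => e e0; have [βe [Γβe βeγ] near] := clo e e0.
  (* The bound at [γ] is only known beyond [βe]; below it, F βe dominates F β. *)
  wlog le_βe : β Γβ βγ / (βe <= β)%E.
    move=> wl; have [|/ltW le] := leP βe β; first exact: wl.
    by rewrite (le_trans _ (wl _ Γβe βeγ (lexx _)))// F_mono//; exact: ΓD.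
  have := near β Γβ le_βe βγ; rewrite IH//; last exact: ΓD.
  by rewrite -EFinD lee_fin ltr_distl => /andP[_ /ltW].
- apply/lee_addgt0Pr => e e0; have [βe [Γβe βeγ] near] := clo e e0.
  have := near βe Γβe (lexx _) βeγ; rewrite ltr_distl => /andP[lb _].
  apply: (@le_trans _ _ (F βe + e%:E)%E).
    by rewrite IH//; [rewrite -EFinD lee_fin -lerBlDr ltW|exact: ΓD].
  by rewrite leeD2r// ereal_sup_ubound//; exists βe.
Qed.

Lemma partial_sums_fine : (forall γ, D γ -> (F γ < +oo)%E) ->
  partial_sums Γ D x (fine \o F).
Proof.
move=> Ffin.
have F_num γ : D γ -> F γ \is a fin_num.
  move=> Dγ; rewrite ge0_fin_numE ?Ffin// -Fm F_mono//; last exact: min_le.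
  exact/ΓD/Γm.1.
split=> /=.
- move=> m' Γm' _; suff -> : m' = m by rewrite Fm.
  by apply/eqP; rewrite eq_le Γm'.2 ?Γm.2//; [exact: Γm'.1|exact: Γm.1].
- by move=> β γ Γβ Dγ sβ; rewrite (F_succ Γβ sβ) fineD//; exact/F_num/ΓD.
- move=> m' γ Γm' Dγ m'γ nosucc e e0.
  have mγ : (m < γ)%E by apply: le_lt_trans m'γ; apply: Γm.2; exact: Γm'.1.
  have Fγ := F_lim Dγ mγ nosucc.
  have supfin : ereal_sup (F @` below Γ γ) \is a fin_num by rewrite -Fγ F_num.
  have [_ [βe [Γβe βeγ] <-] lb] := ub_ereal_sup_adherent e0 supfin.
  exists βe => // β Γβ βeβ βγ; rewrite -Fγ in lb.
  have Dβ := ΓD Γβ; have Dβe := ΓD Γβe.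
  have le1 := F_mono Dβe Dβ βeβ.
  have le2 := F_mono Dβ Dγ (ltW βγ).
  move: (F_num _ Dβ) (F_num _ Dγ) le2 (lt_le_trans lb le1) => /=.
  case: (F β) => // u _; case: (F γ) => // v _.
  rewrite -EFinB lee_fin lte_fin /= => uv vu.
  by rewrite distrC ger0_norm ?subr_ge0// ltrBlDl -ltrBlDr.
Qed.

(** Any partial sums coincide with [F], which gives both their uniqueness and the
    finiteness of [F]. *)
Lemma has_unique_partial_sumsP : has_unique_partial_sums Γ D x <->
  (forall γ, D γ -> (F γ < +oo)%E).
Proof.
split=> [[σ [σP _]] γ Dγ|/partial_sums_fine FP].
  by rewrite (partial_sumsE σP Dγ) ltry.
exists (fine \o F); split=> // σ' σ'P γ Dγ /=.
by rewrite (partial_sumsE σ'P Dγ).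
Qed.

End monotone_partial_sums.
End order_sums.

(** * Functions constant on countably many pieces *)

Section countable_pieces.
Context {d} {T : measurableType d} {I : Type}.
Variables (P : set I) (A : I -> set T).
Hypotheses (cP : countable P) (mA : forall i, P i -> measurable (A i)).

Lemma countable_bigcup_measurable : measurable (\bigcup_(i in P) A i).
Proof.
have /countable_injP[f finj] := cP.
have -> : \bigcup_(i in P) A i =
    \bigcup_n \bigcup_(i in P `&` f @^-1` [set n]) A i.
  apply/seteqP; split=> [t [i Pi Ait]|t [n _ [i [Pi _] Ait]]]; last by exists i.
  by exists (f i) => //; exists i.
apply: bigcupT_measurable => n.
have [[i [Pi fin]]|empty] := pselect (P `&` f @^-1` [set n] !=set0).
  rewrite (_ : P `&` _ = [set i]) ?bigcup_set1; first exact: mA.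
  apply/seteqP; split=> [j [Pj fjn]|_ ->//].
  by apply: finj; rewrite ?inE// fjn -fin.
rewrite (_ : P `&` _ = set0) ?bigcup_set0//; apply/seteqP; split=> // i Pi.
by apply: empty; exists i.
Qed.

End countable_pieces.

Section piecewise_constant.
Context {d} {T : measurableType d} {I U : Type}.
Variables (P : set I) (A : I -> set T) (y : I -> U) (g : T -> U).
Hypotheses (cP : countable P) (mA : forall i, P i -> measurable (A i)).
Hypothesis gA : forall i t, P i -> A i t -> g t = y i.

Lemma piecewise_constant_preimage_measurable (D : set T) (Y : set U) :
  measurable D -> D `<=` \bigcup_(i in P) A i -> measurable (D `&` g @^-1` Y).
Proof.
move=> mD DA.
have -> : D `&` g @^-1` Y = D `&` \bigcup_(i in P `&` y @^-1` Y) A i.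
  apply/seteqP; split=> t [Dt].
    move=> Ygt; split=> //; have [i Pi Ait] := DA t Dt; exists i => //.
    by split; rewrite //= -(gA Pi Ait).
  by move=> [i [Pi Yyi] Ait]; split; rewrite //= (gA Pi Ait).
apply: measurableI => //; apply: countable_bigcup_measurable => [|i [Pi _]].
  by apply: sub_countable cP; apply: subset_card_le; exact: subIsetl.
exact: mA.
Qed.

End piecewise_constant.

Section strong_measurability.
Context {R : realType} {E : normedModType R} {I : Type}.
Variables (P : set I) (A : I -> set R) (y : I -> E) (g : R -> E).
Hypotheses (cP : countable P).
Hypothesis (mA : forall i, P i -> measurable (A i : set (lebesgueTypeR R))).
Hypothesis gA : forall i t, P i -> A i t -> g t = y i.

(** The simple functions are [g] cut off to finitely many pieces, the rank of a
    piece being given by an injection [f] into [nat].  A point lying in the piece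
    [i] sees the sequence become constant from rank [f i] on. *)
Lemma piecewise_constant_strongly_measurable (D : set R) :
  measurable (D : set (lebesgueTypeR R)) -> D `<=` \bigcup_(i in P) A i ->
  strongly_measurable D g.
Proof.
move=> mD DA; have /countable_injP[f finj] := cP.
pose P_ n := P `&` f @^-1` `I_n.
pose U n := \bigcup_(i in P_ n) A i.
have cPn n : countable (P_ n).
  by apply: sub_countable cP; apply: subset_card_le; exact: subIsetl.
have mU n : measurable (U n : set (lebesgueTypeR R)).
  by apply: countable_bigcup_measurable => // i [Pi _]; exact: mA.
pose s n t := if t \in U n then g t else 0.
exists s; split=> [n|].
  split=> [|w].
  - apply: (@sub_finite_set _ _ ([set 0] `|` y @` P_ n)).
      move=> _ [t Dt <-]; rewrite /s; case: ifPn => [|_]; last by left.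
      rewrite inE => -[i Pi Ait]; right; exists i => //.
      by rewrite (gA Pi.1 Ait).
    rewrite finite_setU; split=> //; apply: finite_image.
    have Pf : {in P_ n &, injective f}.
      by move=> i j; rewrite !inE => -[Pi _] [Pj _]; apply: finj; rewrite inE.
    rewrite -(eq_finite_set (inj_card_eq Pf)).
    by apply: sub_finite_set (finite_II n) => _ [i [_ fi] <-].
  - have -> : D `&` s n @^-1` [set w] = (D `&` U n `&` g @^-1` [set w])
        `|` ((D `\` U n) `&` cst (0 : E) @^-1` [set w]).
      apply/seteqP; split=> t.
        move=> [Dt]; rewrite /= /s.
        case: ifPn; rewrite ?inE ?notin_setE => Ut wt.
          by left.
        by right.
      move=> [[[Dt Ut] wt]|[[Dt Ut] wt]]; split=> //=; rewrite /s.
        by rewrite mem_set.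
      by rewrite memNset.
    apply: measurableU.
      apply: (piecewise_constant_preimage_measurable cP mA gA).
        exact: measurableI.
      by apply: subset_trans DA; exact: subIsetl.
    rewrite preimage_cst; case: ifP => _; rewrite ?setIT ?setI0//.
    exact: measurableD.
apply: aeW => t Dt; have [i Pi Ait] := DA t Dt.
apply: cvg_near_cst; near=> n.
rewrite /s mem_set//; exists i => //; split=> //=.
by near: n; exact: nbhs_infty_gt.
Unshelve. all: by end_near.
Qed.

End strong_measurability.

(** * Partitions of an interval into well ordered steps *)

(** The intervals [α, S α) with [α] in [Γ] are the consecutive steps of [a, b).
    There may be a last step, ending at [b], or the steps may accumulate at [b];
    keeping [S] abstract and [b] extended real lets both parts of the theorem
    share one argument. *)
Record step_partition (R : realType) (Γ : set R) (S : R -> R) (a : R)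
    (b : \bar R) : Prop := StepPartition {
  sp_wo : well_ordered Γ;
  sp_min : is_minimum Γ a;
  sp_lt : forall α, Γ α -> α < S α;
  sp_le : forall α β, Γ α -> Γ β -> α < β -> S α <= β;
  sp_bound : forall α, Γ α -> ((S α)%:E <= b)%E;
  sp_cover : forall t, a <= t -> (t%:E < b)%E -> exists2 α, Γ α & α <= t < S α }.

Section step_partition_theory.
Context {R : realType} (Γ : set R) (S : R -> R) (a : R) (b : \bar R).
Hypothesis part : step_partition Γ S a b.
Implicit Types (α β t u : R).

Lemma step_partition_lt α : Γ α -> (α%:E < b)%E.
Proof.
by move=> Γα; rewrite (lt_le_trans _ (sp_bound part Γα))// lte_fin (sp_lt part).
Qed.

Lemma step_partition_index_le α β t : Γ α -> Γ β -> t < S α -> β <= t -> β <= α.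
Proof.
move=> Γα Γβ tS βt; rewrite leNgt; apply/negP => αβ.
by have := lt_le_trans tS (le_trans (sp_le part Γα Γβ αβ) βt); rewrite ltxx.
Qed.

(** The interiors of the steps are disjoint nonempty open sets of reals. *)
Lemma step_partition_countable : countable Γ.
Proof.
pose B α := if α < S α then `]α, S α[%classic else setT.
apply: (@separated_open_countable R _ B).
- by move=> α; rewrite /B; case: ifP => _; [exact: itv_open|exact: openT].
- move=> α; rewrite /B; case: ifPn => [lt|_]; last by exists 0.
  by exists ((α + S α) / 2); rewrite /= in_itv/= !midf_lt.
- move=> α β Γα Γβ [t []]; rewrite /B !(sp_lt part)//=.
  rewrite !in_itv/= => /andP[αt tSα] /andP[βt tSβ].
  apply/eqP; rewrite eq_le; apply/andP; split.
    exact: step_partition_index_le Γβ Γα tSβ (ltW αt).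
  exact: step_partition_index_le Γα Γβ tSα (ltW βt).
Qed.

(** The end [S α] lies in some step, and a step starting before [S α] ends
    there at the latest. *)
Lemma step_partition_next α : Γ α -> ((S α)%:E < b)%E -> Γ (S α).
Proof.
move=> Γα Sb; have lt_S := sp_lt part.
have aS : a <= S α by rewrite (le_trans ((sp_min part).2 _ Γα)) ?ltW ?lt_S.
have [β Γβ /andP[βS Sβ]] := sp_cover part aS Sb.
suff -> : S α = β by [].
apply/eqP; rewrite eq_le βS andbT (sp_le part)// ltNge; apply/negP => βα.
have : S β <= S α.
  move: βα; rewrite le_eqVlt => /predU1P[->//|βα].
  by rewrite (le_trans (sp_le part Γβ Γα βα))// ltW ?lt_S.
by rewrite leNgt Sβ.
Qed.

Lemma step_partition_successor β γ : Γ β -> is_successor Γ β γ -> γ = S β.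
Proof.
move=> Γβ [[Γγ βγ] γmin]; apply/eqP; rewrite eq_le (sp_le part)// andbT.
rewrite leNgt; apply/negP => Sγ; have ΓS : Γ (S β).
  apply: step_partition_next => //.
  by rewrite (lt_trans _ (step_partition_lt Γγ))// lte_fin.
by have := γmin (S β) (conj ΓS (sp_lt part Γβ)); rewrite leNgt Sγ.
Qed.

(** The step containing [t] ends before [γ], for otherwise [γ] would be the
    successor of its starting point; and where it ends, another step starts. *)
Lemma step_partition_limit γ t : Γ γ ->
  ~ (exists2 β, Γ β & is_successor Γ β γ) -> a <= t -> t < γ ->
  exists2 β, Γ β & t < β < γ.
Proof.
move=> Γγ nosucc at' tγ.
have [|α Γα /andP[αt tS]] := sp_cover part at'.
  by rewrite (lt_trans _ (step_partition_lt Γγ))// lte_fin.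
have αγ := le_lt_trans αt tγ.
have := sp_le part Γα Γγ αγ; rewrite le_eqVlt => /predU1P[Sγ|Sγ].
  case: nosucc; exists α => //; split=> // z [Γz αz].
  by rewrite -Sγ (sp_le part).
exists (S α); last by rewrite tS.
apply: step_partition_next => //.
by rewrite (lt_trans _ (step_partition_lt Γγ))// lte_fin.
Qed.

End step_partition_theory.

(** * Left continuity of the integral *)

Section integral_left_continuity.
Context {R : realType}.
Local Notation mu := (@completed_lebesgue_measure R).

Lemma lebesgue_measurable_itv (i : interval R) :
  measurable ([set` i] : set (lebesgueTypeR R)).
Proof. by apply: sub_caratheodory; exact: measurable_itv. Qed.

(** Monotone convergence along the intervals [a, u n), where [u n] increases
    to [t]. *)
Lemma ge0_integral_itv_left_continuous (h : lebesgueTypeR R -> \bar R)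
    (a t : R) (M : \bar R) :
  a < t -> measurable_fun (`[a, t[ : set (lebesgueTypeR R)) h ->
  (forall u, (0 <= h u)%E) ->
  (forall u, a <= u -> u < t -> (\int[mu]_(x in `[a, u[) h x <= M)%E) ->
  (\int[mu]_(x in `[a, t[) h x <= M)%E.
Proof.
move=> ltat mh h0 leM.
pose u n : R := t - (t - a) * n.+1%:R^-1.
have ut n : u n < t by rewrite gtrBl mulr_gt0 ?subr_gt0 ?invr_gt0.
have au n : a <= u n.
  by rewrite lerBrDr -lerBrDl ler_piMr ?subr_ge0 ?(ltW ltat)// invf_le1 ?ler1n.
have cupE : \bigcup_n `[a, u n[%classic = `[a, t[%classic.
  apply/seteqP; split=> x.
    by move=> [n _]; rewrite /= !in_itv/= => /andP[-> /lt_trans->].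
  rewrite /= in_itv/= => /andP[ax xt].
  exists (Num.bound ((t - a) / (t - x))) => //=; rewrite in_itv/= ax/=.
  rewrite ltrBrDr -ltrBrDl ltr_pdivrMr// mulrC -ltr_pdivrMr ?subr_gt0//.
  apply: lt_le_trans (archi_boundP _) _; rewrite ?ler_nat//.
  by rewrite divr_ge0// subr_ge0 ltW.
have := @ge0_nondecreasing_set_cvg_integral _ (lebesgueTypeR R) R
  (fun n => `[a, u n[%classic) h mu.
rewrite cupE => cvgu; apply: (cvge_to_le (cvgu _ _ _ _)).
- apply/nondecreasing_seqP => n; rewrite subsetEset => x /=.
  rewrite !in_itv/= => /andP[-> /lt_le_trans->]//.
  by rewrite lerB// ler_wpM2l ?subr_ge0 ?(ltW ltat)// lef_pV2 ?posrE// ler_nat.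
- by move=> n; exact: lebesgue_measurable_itv.
- move=> n; apply: measurable_funS mh; first exact: lebesgue_measurable_itv.
  by move=> x; rewrite /= !in_itv/= => /andP[-> /lt_trans->].
- by [].
- by apply: nearW => n; exact: leM.
Qed.

End integral_left_continuity.

(** * Step functions on a step partition *)

Section step_function.
Context {R : realType} {E : normedModType R}.
Variables (Γ : set R) (S : R -> R) (a : R) (b : \bar R) (z g : R -> E).
Hypothesis part : step_partition Γ S a b.
Hypothesis g_step : forall α t, Γ α -> α <= t < S α -> g t = z α.
Local Notation mu := (@completed_lebesgue_measure R).
Local Notation h := (fun t : lebesgueTypeR R => `|g t|%:E).
Local Notation F t := (\int[mu]_(x in `[a, t[) `|g x|%:E)%E.

Let g_min α : Γ α -> g α = z α.
Proof. by move=> Γα; apply: g_step; rewrite ?lexx ?(sp_lt part). Qed.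

(** [d] may be the right end [b], which belongs to no step; the singleton
    [set d] is then needed to cover [a, d]. *)
Let piece d α : set R := if α == d then [set d] else `[α, S α[%classic.

Let piece_measurable d α : measurable (piece d α : set (lebesgueTypeR R)).
Proof.
rewrite /piece; case: ifP => _; last exact: lebesgue_measurable_itv.
by rewrite -set_itv1; exact: lebesgue_measurable_itv.
Qed.

Let pieces_countable d : countable (Γ `|` [set d]).
Proof.
rewrite -bigcup2E; apply: bigcup_countable => // -[|[|n]] _ //=.
exact: step_partition_countable part.
Qed.

Let piece_cover d D : (d%:E <= b)%E -> D `<=` `[a, d]%classic ->
  D `<=` \bigcup_(α in Γ `|` [set d]) piece d α.
Proof.
move=> db DI t /DI; rewrite /= in_itv/= => /andP[at'].
rewrite le_eqVlt => /predU1P[->|td].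
  by exists d; [right|rewrite /piece eqxx].
have [|α Γα /andP[αt tS]] := sp_cover part at'.
  by rewrite (lt_le_trans _ db)// lte_fin.
exists α; first by left.
by rewrite /piece lt_eqF ?(le_lt_trans αt)//= in_itv/= αt.
Qed.

Let piece_const d α t : (Γ `|` [set d]) α -> piece d α t -> g t = g α.
Proof.
rewrite /piece; have [->|neq] := eqVneq α d; first by move=> _ ->.
case=> [Γα|/= eq]; last by rewrite eq eqxx in neq.
by rewrite /= in_itv/= => /(g_step Γα) ->; rewrite g_min.
Qed.

Lemma step_function_norm_measurable d (D : set (lebesgueTypeR R)) :
  (d%:E <= b)%E -> D `<=` `[a, d]%classic -> measurable_fun D h.
Proof.
move=> db DI mD Y _.
apply: (@piecewise_constant_preimage_measurable _ (lebesgueTypeR R) _ _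
  (Γ `|` [set d]) (piece d) (fun α => `|g α|%:E)) => //.
- by move=> α t Pα /(piece_const Pα) ->.
- exact: piece_cover db DI.
Qed.

Lemma step_function_bochnerP d (D : set R) : (d%:E <= b)%E ->
  measurable (D : set (lebesgueTypeR R)) -> D `<=` `[a, d]%classic ->
  bochner_integrable D g <-> (\int[mu]_(t in D) `|g t|%:E < +oo)%E.
Proof.
move=> db mD DI; split=> [[_ /integrableP[_]]|gfin].
  by under eq_integral do rewrite abse_EFin normr_id.
split.
  apply: (@piecewise_constant_strongly_measurable _ _ _
    (Γ `|` [set d]) (piece d) g) => //.
  - exact: piece_const.
  - exact: piece_cover db DI.
apply/integrableP; split; first exact: step_function_norm_measurable DI.
by under eq_integral do rewrite abse_EFin normr_id.
Qed.

Lemma step_function_le_integral d (A B : set R) : (d%:E <= b)%E ->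
  measurable (A : set (lebesgueTypeR R)) ->
  measurable (B : set (lebesgueTypeR R)) ->
  A `<=` B -> B `<=` `[a, d]%classic ->
  (\int[mu]_(t in A) `|g t|%:E <= \int[mu]_(t in B) `|g t|%:E)%E.
Proof.
move=> db mA mB AB BI; apply: ge0_subset_integral => //.
exact: step_function_norm_measurable BI.
Qed.

Lemma step_function_integral_succ α : Γ α ->
  F (S α) = (F α + `|(S α - α) *: z α|%:E)%E.
Proof.
move=> Γα; have aα := (sp_min part).2 _ Γα; have αS := sp_lt part Γα.
have -> : `[a, S α[%classic = `[a, α[ `|` `[α, S α[.
  by rewrite -itv_bndbnd_setU// bnd_simp// ltW.
rewrite ge0_integral_setU//=; first last.
- apply/disj_setPS => x; rewrite /= !in_itv/= => -[/andP[_ xα] /andP[αx _]].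
  by have := lt_le_trans xα αx; rewrite ltxx.
- apply: (step_function_norm_measurable (sp_bound part Γα)) => x.
  rewrite /= !in_itv/= => -[] /andP[lx xu].
    by rewrite lx ltW// (lt_trans xu).
  by rewrite (le_trans aα)//= ltW.
- exact: lebesgue_measurable_itv.
- exact: lebesgue_measurable_itv.
congr (_ + _)%E.
rewrite (eq_integral (cst `|z α|%:E)); last first.
  by move=> t; rewrite inE/= in_itv/= => /(g_step Γα) ->.
rewrite integral_cst; last exact: lebesgue_measurable_itv.
rewrite [X in (_ * X)%E](_ : _ = lebesgue_measure `[α, S α[%classic)//.
rewrite lebesgue_measure_itv/= lte_fin αS -EFinB -EFinM.
by rewrite mulrC normrZ gtr0_norm ?subr_gt0.
Qed.

Lemma step_function_integral_itvcc d : (d%:E <= b)%E -> a <= d ->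
  (\int[mu]_(t in `[a, d]) `|g t|%:E)%E = F d.
Proof.
move=> db ad.
have md1 : measurable ([set d] : set (lebesgueTypeR R)).
  by rewrite -set_itv1; exact: lebesgue_measurable_itv.
have dE : `[a, d]%classic = `[a, d[ `|` [set d] by rewrite setUitv1.
rewrite dE ge0_integral_setU//=; first last.
- apply/disj_setPS => x [/=]; rewrite in_itv/= => /[swap] ->.
  by rewrite ltxx andbF.
- by rewrite -dE; exact: step_function_norm_measurable db _.
- exact: lebesgue_measurable_itv.
rewrite [X in (_ + X)%E](_ : _ = 0%E) ?adde0//.
rewrite (eq_integral (cst `|g d|%:E)); last first.
  by move=> t; rewrite inE/= => ->.
rewrite integral_cst// [X in (_ * X)%E](_ : _ = lebesgue_measure [set d])//.
by rewrite lebesgue_measure_set1 mule0.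
Qed.

(** The integral [F] satisfies the rules of [has_unique_partial_sumsP] for the
    norms of [(S α - α) *: z α].  The set [D] stands for [Γ], or for [Γ] with its
    supremum. *)
Lemma step_function_partial_sumsP (D : set (\bar R)) :
  EFin @` Γ `<=` D -> D `<=` EFin @` Γ `|` [set ereal_sup (EFin @` Γ)] ->
  (forall γ, D γ -> γ \is a fin_num) ->
  has_unique_partial_sums (EFin @` Γ) D
    (fun γ => `|((fun α => (S α - α) *: z α) \o fine) γ| : R^o) <->
  (forall t, D t%:E -> (F t < +oo)%E).
Proof.
move=> ΓD DΓ Dfin; have Γa := (sp_min part).1.
have a_min := (sp_min part).2.
have woΓ : well_ordered (EFin @` Γ).
  move=> B BΓ [_ /[dup] /BΓ[β Γβ <-] Bβ].
  have [||m [[Γm Bm] mmin]] := sp_wo part (B := Γ `&` EFin @^-1` B).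
  - exact: subIsetl.
  - by exists β.
  - exists m%:E; split=> // _ /[dup] /BΓ[c Γc <-] Bc.
    by rewrite lee_fin; exact: mmin.
have minΓ : is_minimum (EFin @` Γ) a%:E.
  by split=> [|_ [c Γc <-]]; [exists a|rewrite lee_fin; exact: a_min].
have D_le t : D t%:E -> (t%:E <= b)%E.
  move=> /DΓ[[c Γc <-]|->]; first exact/ltW/(step_partition_lt part).
  by apply: ge_ereal_sup => _ [c Γc <-]; exact/ltW/(step_partition_lt part).
have F_le u t : (t%:E <= b)%E -> u <= t -> (F u <= F t)%E.
  move=> tb ut; apply: (step_function_le_integral tb).
  - exact: lebesgue_measurable_itv.
  - exact: lebesgue_measurable_itv.
  - by move=> y; rewrite /= !in_itv/= => /andP[-> /lt_le_trans->].
  - by move=> y; rewrite /= !in_itv/= => /andP[-> /ltW].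
rewrite (has_unique_partial_sumsP woΓ minΓ ΓD DΓ (F := fun γ => F (fine γ))).
- split=> [fin t Dt|fin γ Dγ]; first exact: fin Dt.
  by apply: fin; rewrite fineK// Dfin.
- by rewrite set_itvco0 integral_set0.
- move=> _ γ [β Γβ <-] [[[c Γc <-] βc] cmin] /=.
  have -> : c = S β.
    apply: (step_partition_successor part Γβ); split=> // c' [Γc' βc'].
    by rewrite -lee_fin; apply: cmin; split; [exists c'|].
  by rewrite step_function_integral_succ.
- move=> γ Dγ; have := Dfin _ Dγ.
  case: γ Dγ => // t Dt _; rewrite lte_fin => ltat nosucc /=.
  apply/eqP; rewrite eq_le; apply/andP; split; last first.
    apply: ge_ereal_sup => _ [_ [[β Γβ <-] βt] <-] /=.
    by apply: F_le; [exact: D_le|exact: ltW].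
  apply: ge0_integral_itv_left_continuous => //.
    apply: (step_function_norm_measurable (D_le _ Dt)) => y.
    by rewrite /= !in_itv/= => /andP[-> /ltW].
  move=> u au ut.
  have [β Γβ /andP[uβ βt]] : exists2 β, Γ β & u < β < t.
    (* If [t] is not in [Γ], it is the supremum of [Γ], hence a limit of [Γ]. *)
    have [Γt|nΓt] := pselect (Γ t).
      apply: (step_partition_limit part) => // -[β Γβ sβ].
      apply: nosucc; exists β%:E; first by exists β.
      split=> [|_ [[c' Γc' <-] βc']]; first by split; [exists t|exact: sβ.1.2].
      by rewrite lee_fin; apply: sβ.2.
    have tsup : t%:E = ereal_sup (EFin @` Γ).
      by have [[c Γc [ct]]|//] := DΓ _ Dt; case: nΓt; rewrite -ct.
    have [_ [β Γβ <-]] : exists2 y, (EFin @` Γ) y & (u%:E < y)%E.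
      by apply: ereal_sup_gt; rewrite -tsup lte_fin.
    rewrite lte_fin => uβ; exists β => //; rewrite uβ /= lt_neqAle.
    apply/andP; split; first by apply/eqP => βt; rewrite βt in Γβ.
    by rewrite -lee_fin tsup ereal_sup_ubound//; exists β.
  apply: le_ereal_sup_tmp; exists (F β).
    by exists β%:E.
  by apply: F_le; [exact/ltW/(step_partition_lt part)|exact: ltW].
- move=> β γ Dβ Dγ βγ; apply: F_le; last by apply: fine_le => //; exact: Dfin.
  by apply: D_le; rewrite fineK// Dfin.
Qed.

End step_function.

(** * Integrability and absolute summability *)

Lemma successorP {d : Order.disp_t} {T : porderType d} (A : set T) (α γ : T) :
  well_ordered A -> A γ -> (α < γ)%O -> is_successor A α (successor A α).
Proof.
move=> woA Aγ αγ; have [| |β sβ] := woA [set y | A y /\ (α < y)%O].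
- by move=> y [].
- by exists γ.
- by apply: xgetPex; exists β.
Qed.

Lemma successor_step_partition (R : realType) (Λ Γ : set R) (a : R)
    (b : \bar R) : well_ordered Λ -> Γ `<=` Λ -> is_minimum Γ a ->
  (forall α, Γ α -> is_successor Λ α (successor Λ α)) ->
  (forall α, Γ α -> ((successor Λ α)%:E <= b)%E) ->
  [set t | a <= t /\ (t%:E < b)%E] `<=`
    \bigcup_(α in Γ) `[α, successor Λ α[%classic ->
  step_partition Γ (successor Λ) a b.
Proof.
move=> woΛ ΓΛ Γa sP Sb cover; split=> //.
- by move=> B BΓ; apply: woΛ; exact: subset_trans ΓΛ.
- by move=> α /sP[[]].
- by move=> α β /sP[_ smin] Γβ αβ; apply: smin; split=> //; exact: ΓΛ.
- move=> t at' tb; have [α Γα] := cover t (conj at' tb).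
  by rewrite /= in_itv/=; exists α.
Qed.

Theorem proposition3p4 (R : realType) (E : completeNormedModType R) :
  (forall (a b : R) (Λ : set R) (z g : R -> E),
    a < b ->
    well_ordered Λ -> Λ `<=` `[a, b] -> is_minimum Λ a -> is_maximum Λ b ->
    `[a, b[%classic = \bigcup_(α in below Λ b) `[α, successor Λ α[%classic ->
    trivIset (below Λ b) (fun α => `[α, successor Λ α[%classic) ->
    (forall α t, below Λ b α -> t \in `[α, successor Λ α[ -> g t = z α) ->
    (bochner_integrable `[a, b] g <->
     absolutely_wo_summable (EFin @` below Λ b)
       ((fun α => (successor Λ α - α) *: z α) \o fine))) /\
  (forall (a : R) (b : \bar R) (Λ : set R) (z g : R -> E),
    (a%:E < b)%E ->
    well_ordered Λ -> Λ `<=` [set t | a <= t /\ (t%:E < b)%E] ->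
    is_minimum Λ a -> ereal_sup (EFin @` Λ) = b ->
    [set t | a <= t /\ (t%:E < b)%E] = \bigcup_(α in Λ) `[α, successor Λ α[%classic ->
    trivIset Λ (fun α => `[α, successor Λ α[%classic) ->
    (forall α t, Λ α -> t \in `[α, successor Λ α[ -> g t = z α) ->
    (locally_bochner_integrable a b g <->
     locally_absolutely_wo_summable (EFin @` Λ)
       ((fun α => (successor Λ α - α) *: z α) \o fine))).
Proof.
split=> a b Λ z g ab woΛ Λab Λa Λb cover _ gz.
- have sP α : below Λ b α -> is_successor Λ α (successor Λ α).
    by move=> [_ αb]; exact: successorP woΛ Λb.1 αb.
  have part : step_partition (below Λ b) (successor Λ) a b%:E.
    apply: (successor_step_partition woΛ) => //.
    + by move=> α [].
    + by split=> [|α [Λα _]]; [split=> //; exact: Λa.1|exact: Λa.2].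
    + move=> α Γα; rewrite lee_fin; apply: (sP α Γα).2.
      by split; [exact: Λb.1|exact: Γα.2].
    + by move=> t [at' tb]; rewrite -cover /= in_itv/= at' -lte_fin.
  have g_step α t : below Λ b α -> α <= t < successor Λ α -> g t = z α.
    by move=> Γα It; apply: gz.
  set s := ereal_sup (EFin @` below Λ b).
  have as' : (a%:E <= s)%E.
    by apply: ereal_sup_ubound; exists a => //; exact: (sp_min part).1.
  have sb : (s <= b%:E)%E.
    by apply: ge_ereal_sup => _ [α [_ αb] <-]; rewrite lee_fin ltW.
  have mcc := @lebesgue_measurable_itv R `[a, b].
  rewrite (step_function_bochnerP part g_step (lexx _) mcc)//.
  rewrite /absolutely_wo_summable /wo_summable.
  rewrite (step_function_partial_sumsP part g_step); first last.
  + move=> _ [[α _ <-]//|->]; rewrite fin_numE.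
    rewrite gt_eqF ?(lt_le_trans _ as') ?ltNyr//=.
    by rewrite lt_eqF// (le_lt_trans sb) ?ltry.
  + by [].
  + exact: subsetUl.
  split=> [fin t Dt|fin].
    apply: le_lt_trans fin.
    apply: (step_function_le_integral part g_step (lexx _)) => //.
      exact: lebesgue_measurable_itv.
    have tb : t <= b.
      by rewrite -lee_fin; case: Dt => [[α [_ /ltW αb] [<-]]|->].
    by move=> y; rewrite /= !in_itv/= => /andP[-> /ltW/le_trans->].
  have Fb :
      (\int[completed_lebesgue_measure]_(x in `[a, b[) `|g x|%:E < +oo)%E.
    have s_num : s \is a fin_num.
      rewrite fin_real// (lt_le_trans (ltNyr a) as').
      by rewrite (le_lt_trans sb (ltry b)).
    have [sb'|bs] := ltP s b%:E; last first.
      have sbE : s = b%:E by apply/eqP; rewrite eq_le sb bs.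
      by apply: fin; right; rewrite /= -sbE.
    (* If the indices below [b] stop short of [b], the step containing their
       supremum ends at [b]. *)
    have as'' : a <= fine s by rewrite -lee_fin fineK.
    have [|α Γα /andP[αs sS]] := sp_cover part as''; first by rewrite fineK.
    have SbE : successor Λ α = b.
      apply/eqP; rewrite eq_le -lee_fin (sp_bound part Γα) leNgt /=.
      apply/negP => Sb; have ΓS := step_partition_next part Γα Sb.
      have : ((successor Λ α)%:E <= s)%E.
        by apply: ereal_sup_ubound; exists (successor Λ α).
      by rewrite -(fineK s_num) lee_fin leNgt sS.
    rewrite -SbE (step_function_integral_succ part g_step Γα).
    rewrite lte_add_pinfty ?ltry//.
    by apply: fin; left; exists α.
  by rewrite (step_function_integral_itvcc part g_step)// ltW.
- have sP α : Λ α -> is_successor Λ α (successor Λ α).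
    move=> Λα; have : (α%:E < ereal_sup (EFin @` Λ))%E.
      by rewrite Λb; exact: (Λab α Λα).2.
    by move=> /ereal_sup_gt[_ [β Λβ <-]]; rewrite lte_fin; exact: successorP.
  have part : step_partition Λ (successor Λ) a b.
    apply: (successor_step_partition woΛ) => //; last by rewrite cover.
    by move=> α Λα; apply: ltW; have [[/Λab[]]] := sP α Λα.
  have g_step α t : Λ α -> α <= t < successor Λ α -> g t = z α.
    by move=> Γα It; apply: gz.
  rewrite /locally_absolutely_wo_summable /locally_wo_summable.
  rewrite (step_function_partial_sumsP part g_step)//; first last.
  + by move=> _ [α _ <-].
  split=> [loc t [t' Λt' [tE]]|fin c d ac cd db].
    rewrite {t'}tE in Λt'; have [at' tb] := Λab t Λt'.
    have mcc := @lebesgue_measurable_itv R `[a, t].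
    have := loc a t (lexx _) at' tb.
    rewrite (step_function_bochnerP part g_step (ltW tb) mcc)//.
    apply: le_lt_trans.
    apply: (step_function_le_integral part g_step (ltW tb)) => //.
      exact: lebesgue_measurable_itv.
    by move=> y; rewrite /= !in_itv/= => /andP[-> /ltW].
  have mcd := @lebesgue_measurable_itv R `[c, d].
  rewrite (step_function_bochnerP part g_step (ltW db) mcd); last first.
    by move=> y; rewrite /= !in_itv/= => /andP[/(le_trans ac)->].
  have [α Λα /andP[αd dS]] := sp_cover part (le_trans ac cd) db.
  have ΛS : Λ (successor Λ α) by have [[]] := sP α Λα.
  apply: le_lt_trans (fin (successor Λ α) _); last by exists (successor Λ α).
  apply: (step_function_le_integral part g_step (sp_bound part Λα)) => //.
  + exact: lebesgue_measurable_itv.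
  + move=> y; rewrite /= !in_itv/= => /andP[cy yd].
    by rewrite (le_trans ac)//= (le_lt_trans yd).
  + by move=> y; rewrite /= !in_itv/= => /andP[-> /ltW].
Qed.
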